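(* The class of properties $\{\mathcal{F}_{(C_k,\Sigma)} : k\ge 3,\ \Sigma\in\{0,1\}^k,\ \Sigma\ne 0^k,\ \Sigma\ne 1^k\}$ is finite; that is, as $k$ and $\Sigma$ vary, only finitely many distinct properties occur.
   Context: $\{0,1\}$ is identified with the field $\mathbb{F}_2$, and $\{0,1\}^n$ with $\mathbb{F}_2^n$. $C_k$ denotes the cycle on $k$ vertices. For $\Sigma\in\{0,1\}^k$, a function $f:\{0,1\}^n\to\{0,1\}$ is $(C_k,\Sigma)$-free if there are no $x_1,\ldots,x_k\in\{0,1\}^n$ (not necessarily distinct) with $\sum_{i=1}^k x_i=0$ and $\langle f(x_1),\ldots,f(x_k)\rangle=\Sigma$. (Equivalently, representing the graphic matroid of $C_k$ by $v_i=e_i$ for $i\le k-1$ and $v_k=e_1+\cdots+e_{k-1}$ in $\{0,1\}^k$, for every linear map $L:\{0,1\}^k\to\{0,1\}^n$ one has $\langle f(L(v_1)),\ldots,f(L(v_k))\rangle\neq\Sigma$.) The property $\mathcal{F}_{(C_k,\Sigma)}$ consists of the family of $(C_k,\Sigma)$-free functions on $\{0,1\}^n$ for every positive integer $n$; two properties are equal if they have the same family for every $n$. *)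

(* Defs.v *)
From mathcomp Require Import all_boot all_algebra.
From mathcomp Require Import classical_sets cardinality.

Set Implicit Arguments.
Unset Strict Implicit.
Unset Printing Implicit Defensive.

Import GRing.Theory.

Local Open Scope ring_scope.
Local Open Scope classical_set_scope.

Definition cycle_free (k : nat) (Sigma : 'rV['F_2]_k) (n : nat)
    (f : 'rV['F_2]_n -> 'F_2) : Prop :=
  ~ exists x : 'I_k -> 'rV['F_2]_n,
      \sum_(i < k) x i = 0 /\ \row_(i < k) f (x i) = Sigma.

(* The index n stands for the dimension n.+1, so that exactly the positive
   dimensions occur. *)
Definition property : Type := forall n : nat, set ('rV['F_2]_n.+1 -> 'F_2).

Definition cycle_free_property (k : nat) (Sigma : 'rV['F_2]_k) : property :=
  fun n => [set f | cycle_free Sigma f].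

(* Main.v *)
Require Import Defs.
From mathcomp Require Import all_boot all_algebra.
From mathcomp Require Import classical_sets cardinality.
From mathcomp Require Import boolp.

(** Since the condition that the sum vanishes is symmetric, whether [f] is
    free for [Sigma] depends only on the numbers [a] of zeros and [b] of ones
    in [Sigma], both positive. It is enough to see that, when a colour [q]
    occurs, five occurrences of the other colour [p] can be traded for three
    ([realizes_5_3]): then [a] and [b] can be lowered until both lie between 1
    and 4, and at most sixteen properties remain.

    Going from three occurrences to five is possible because any vector may be
    repeated twice more in characteristic 2. Conversely, take vectors
    [x1, ..., x5] of colour [p] and [y] of colour [q] in a vanishing sum. If
    [u = x1 + x2 + x3] has colour [p], it replaces its three summands; if
    [v = x4 + x5 + y] has colour [q], it replaces its three summands. Otherwise
    the two sums have exchanged colours: [u] has colour [q] and [v] has colour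
    [p], so [v, v, v, u] replaces all six vectors. *)

Set Implicit Arguments.
Unset Strict Implicit.
Unset Printing Implicit Defensive.

Import GRing.Theory.

Local Open Scope ring_scope.
Local Open Scope classical_set_scope.

Definition realizes (n : nat) (f : 'rV['F_2]_n -> 'F_2) (c : seq 'F_2) : Prop :=
  exists w : seq 'rV['F_2]_n, map f w = c /\ \sum_(x <- w) x = 0.

Lemma addrr_F2 (n : nat) (x : 'rV['F_2]_n) : x + x = 0.
Proof.
have two0 : (2%:R : 'F_2) = 0 by apply/val_inj.
by rewrite -mulr2n -scaler_nat two0 scale0r.
Qed.

Lemma F2_two_colours (p q r : 'F_2) : p != q -> r = p \/ r = q.
Proof.
by case: p q r => [[|[|//]] ?] [[|[|//]] ?] [[|[|//]] ?] // _;
  (by left; apply/val_inj) || (by right; apply/val_inj).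
Qed.

Lemma cycle_free_realizes (k : nat) (Sigma : 'rV['F_2]_k) (n : nat)
    (f : 'rV['F_2]_n -> 'F_2) :
  cycle_free Sigma f <-> ~ realizes f [seq Sigma 0 i | i <- enum 'I_k].
Proof.
suff E : (exists x : 'I_k -> 'rV['F_2]_n,
      \sum_(i < k) x i = 0 /\ \row_(i < k) f (x i) = Sigma) <->
    realizes f [seq Sigma 0 i | i <- enum 'I_k].
  by split=> H /E /H.
split=> [[x [sum0 <-]]|[w [fw sum0]]].
  exists [seq x i | i <- enum 'I_k]; split; last by rewrite big_map big_enum.
  by rewrite -map_comp; apply: eq_map => i /=; rewrite mxE.
have sz : size w = k by rewrite -(size_map f) fw size_map size_enum_ord.
exists (fun i => nth 0 w i); split.
  by rewrite -[RHS]sum0 (big_nth 0) big_mkord sz.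
apply/rowP=> i; rewrite mxE -(nth_map 0 0) ?sz // fw.
by rewrite (nth_map i) ?size_enum_ord // nth_ord_enum.
Qed.

Lemma realizes_perm (n : nat) (f : 'rV['F_2]_n -> 'F_2) (c d : seq 'F_2) :
  perm_eq c d -> realizes f c <-> realizes f d.
Proof.
suff impl c' d' : perm_eq c' d' -> realizes f c' -> realizes f d'.
  by move=> cd; split; apply: impl; rewrite // perm_sym.
move=> cd [w [fw sum0]]; move: cd; rewrite perm_sym -fw.
case/(perm_iotaP (f 0)) => Is; rewrite size_map => pIs ->.
exists [seq nth 0 w i | i <- Is]; split.
  rewrite -map_comp; apply/eq_in_map => i.
  by rewrite (perm_mem pIs) mem_iota /= add0n => iw; rewrite (nth_map 0).
rewrite big_map (perm_big _ pIs) /= -[RHS]sum0 [RHS](big_nth 0).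
by rewrite /index_iota subn0.
Qed.

(** The trade must leave one [q] in place, so that it can be iterated, and the
    rest [c] untouched. In the last case of the first direction, the sum [v] is
    used three times to make the number of [p]'s come out as three. *)
Lemma realizes_5_3 (n : nat) (f : 'rV['F_2]_n -> 'F_2) (p q : 'F_2)
    (c : seq 'F_2) :
  p != q ->
  realizes f [:: p, p, p, p, p, q & c] <-> realizes f [:: p, p, p, q & c].
Proof.
move=> pq; split; last first.
  case=> -[[]//|x w] [[fx fw]]; rewrite big_cons => sum0.
  exists [:: x, x, x & w]; split; first by rewrite /= fx fw.
  by rewrite !big_cons [x + (x + _)]addrA addrr_F2 add0r.
case=> -[|x1 [|x2 [|x3 [|x4 [|x5 [|y w]]]]]] [] //= [f1 f2 f3 f4 f5 fy fw].
rewrite !big_cons => sum0.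
have [fu|fu] := F2_two_colours (f (x1 + x2 + x3)) pq.
  exists [:: x1 + x2 + x3, x4, x5, y & w].
  by split; [rewrite /= fu f4 f5 fy fw | rewrite !big_cons -!addrA].
have [fv|fv] := F2_two_colours (f (x4 + x5 + y)) pq; last first.
  exists [:: x1, x2, x3, x4 + x5 + y & w].
  by split; [rewrite /= f1 f2 f3 fv fw | rewrite !big_cons -!addrA].
set v := x4 + x5 + y in fv; set u := x1 + x2 + x3 in fu.
exists [:: v, v, v, u & w]; split; first by rewrite /= fv fu fw.
rewrite !big_cons [v + (v + (u + _))]addrA addrr_F2 add0r addrCA.
by rewrite /u /v -!addrA.
Qed.

(** The bound [i] is chosen before [n] and [f]: equality of properties asks
    for one normal form valid in all dimensions at once. *)
Lemma realizes_lower (p q : 'F_2) (m : nat) :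
  p != q ->
  exists i : 'I_4, forall n (f : 'rV['F_2]_n -> 'F_2) c,
    realizes f (nseq m.+1 p ++ q :: c) <-> realizes f (nseq i.+1 p ++ q :: c).
Proof.
move=> pq; have [k] := ubnP m; elim: k m => // k IHk m mk.
have [m4|m4] := ltnP m 4; first by exists (Ordinal m4).
have [|i Hi] := IHk m.-2; first by case: m mk m4 => [|[|m]] //= /ltnW.
exists i => n f c; rewrite -Hi.
case: m m4 {mk Hi} => [|[|[|[|m]]]] // _.
(* The exchange needs [q] right after the leading [p]'s. *)
have move_q j : perm_eq (nseq j p ++ nseq m p ++ q :: c)
                        (nseq j p ++ q :: nseq m p ++ c).
  by rewrite perm_cat2l -cat1s perm_catCA.
have /(realizes_perm f) -> := move_q 5.
have /(realizes_perm f) -> := move_q 3.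
exact: realizes_5_3.
Qed.

Definition two_block_property (ab : 'I_4 * 'I_4) : property :=
  fun n => [set f | ~ realizes f (nseq ab.1.+1 0 ++ nseq ab.2.+1 1)].

Lemma perm_two_blocks (c : seq 'F_2) :
  perm_eq c (nseq (count_mem 0 c) 0 ++ nseq (count_mem 1 c) 1).
Proof.
apply/allP => r _ /=; apply/eqP; rewrite count_cat !count_nseq /=.
by case: (@F2_two_colours 0 1 r isT) => ->; rewrite /= mul1n mul0n ?addn0.
Qed.

Lemma realizes_two_blocks (c : seq 'F_2) :
  0 \in c -> 1 \in c ->
  exists ab : 'I_4 * 'I_4, forall n (f : 'rV['F_2]_n -> 'F_2),
    realizes f c <-> realizes f (nseq ab.1.+1 0 ++ nseq ab.2.+1 1).
Proof.
rewrite -!has_pred1 !has_count.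
have := perm_two_blocks c.
case: (count_mem 0 c) => // a; case: (count_mem 1 c) => // b c01 _ _.
have [i Hi] := @realizes_lower 0 1 a isT.
have [j Hj] := @realizes_lower 1 0 b isT.
exists (i, j) => n f.
have swap l : perm_eq (nseq i.+1 0 ++ nseq l.+1 1)
                      (nseq l.+1 1 ++ 0 :: nseq i (0 : 'F_2)).
  by rewrite perm_catC.
rewrite (realizes_perm f c01) [nseq b.+1 1]/= Hi.
rewrite -[1 :: nseq b 1]/(nseq b.+1 1).
by rewrite (realizes_perm f (swap b)) Hj (realizes_perm f (swap j)).
Qed.

Lemma F2_entry_nonconstant (k : nat) (Sigma : 'rV['F_2]_k) (p q : 'F_2) :
  p != q -> Sigma != const_mx q -> p \in [seq Sigma 0 i | i <- enum 'I_k].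
Proof.
move=> pq; apply: contraNT => pS; apply/eqP/rowP => i; rewrite mxE.
have [Sp|//] := F2_two_colours (Sigma 0 i) pq.
by case/negP: pS; rewrite -Sp map_f // mem_enum.
Qed.

Theorem theorem2p3 :
  finite_set [set P : property |
    exists (k : nat) (Sigma : 'rV['F_2]_k),
      [/\ (3 <= k)%N, Sigma != 0, Sigma != const_mx 1
        & P = cycle_free_property Sigma]].
Proof.
apply: (@sub_finite_set _ _ (range two_block_property)); last first.
  exact/finite_image/finite_finset.
move=> _ [k [Sigma [_ S0 S1 ->]]].
have [||ab Hab] := @realizes_two_blocks [seq Sigma 0 i | i <- enum 'I_k].
- exact: (@F2_entry_nonconstant _ _ 0 1).
- exact: (@F2_entry_nonconstant _ _ 1 0).
exists ab => //; apply: functional_extensionality_dep => n.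
apply/funext => f; apply/propext.
rewrite /two_block_property /cycle_free_property /mkset /=.
by rewrite cycle_free_realizes Hab.
Qed.
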